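(* Let $b,c\in\mathbb{H}$ be such that the quaternion polynomial $P(x)=x^2+bx+c$ has two roots in $\mathbb{H}$ belonging to different conjugacy classes. Let $f$ be any one of the three iteration functions $N_l$ (Left-Newton), $N_r$ (Right-Newton), $H$ (Halley) associated with $P$, viewed as a mapping from (an open subset of) $\mathbb{R}^4$ into $\mathbb{R}^4$, and let $D(q)=\left(\partial f_i(q)/\partial q_j\right)$ denote its $4\times 4$ real Jacobian matrix at $q$. If $\alpha\in\mathbb{H}$ is a root of $P(x)$, then $\det D(\alpha)=0$. More specifically, the rank of $D(\alpha)$ is at most $2$.
   Context: $\mathbb{H}=\{a_1+a_2\mathbf{i}+a_3\mathbf{j}+a_4\mathbf{k}: a_i\in\mathbb{R}\}$ is the division ring of real quaternions, identified with $\mathbb{R}^4$ via $a_1+a_2\mathbf{i}+a_3\mathbf{j}+a_4\mathbf{k}\leftrightarrow(a_1,a_2,a_3,a_4)$. The conjugacy class of $q\in\mathbb{H}$ is $[q]=\{wqw^{-1}: w\in\mathbb{H}, w\neq 0\}$. The polynomial $P(x)=x^2+bx+c$ and its derivative are evaluated at $q\in\mathbb{H}$ with coefficients on the left: $P(q)=q^2+bq+c$ and $P'(q)=2q+b$. A root of $P$ is a quaternion $q$ with $P(q)=0$. The three iteration functions, defined wherever the inverses involved exist, are: (i) Left-Newton: $N_l(q)=q-P'(q)^{-1}P(q)$; (ii) Right-Newton: $N_r(q)=q-P(q)P'(q)^{-1}$; (iii) Halley: $H(q)=q-P'(q)^{-1}P(q)-P'(q)^{-1}\Delta^{-1}P(q)P'(q)^{-1}P(q)$,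 where $\Delta=P'(q)-P(q)P'(q)^{-1}$. *)

(* Defs.v *)
From HB Require Import structures.
From mathcomp Require Import all_boot all_order all_algebra.
From mathcomp Require Import ring.
From mathcomp Require Import all_classical all_reals all_analysis.

Set Implicit Arguments.
Unset Strict Implicit.
Unset Printing Implicit Defensive.

Import Order.TTheory GRing.Theory Num.Theory.
Import numFieldNormedType.Exports.

Local Open Scope classical_set_scope.
Local Open Scope ring_scope.

(* [Quat a1 a2 a3 a4] is a1 + a2 i + a3 j + a4 k. *)
Record quaternion (R : Type) := Quat { q1 : R; q2 : R; q3 : R; q4 : R }.

Section Encoding.
Variable R : Type.

Definition tuple_of_quat (q : quaternion R) := (q1 q, q2 q, q3 q, q4 q).
Definition quat_of_tuple (t : R * R * R * R) :=
  let: (a1, a2, a3, a4) := t in Quat a1 a2 a3 a4.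

Lemma tuple_of_quatK : cancel tuple_of_quat quat_of_tuple.
Proof. by case. Qed.

End Encoding.

HB.instance Definition _ (R : choiceType) :=
  Choice.copy (quaternion R) (can_type (@tuple_of_quatK R)).

Section Ring.
Variable R : realType.
Implicit Types p q r : quaternion R.

Definition addq p q :=
  Quat (q1 p + q1 q) (q2 p + q2 q) (q3 p + q3 q) (q4 p + q4 q).
Definition oppq q := Quat (- q1 q) (- q2 q) (- q3 q) (- q4 q).

Lemma addqA : associative addq.
Proof. by move=> [????] [????] [????]; rewrite /addq/= !addrA. Qed.
Lemma addqC : commutative addq.
Proof. by move=> [a b c d] [????]; congr Quat; apply: addrC. Qed.
Lemma add0q : left_id (Quat 0 0 0 0) addq.
Proof. by move=> [????]; rewrite /addq/= !add0r. Qed.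
Lemma addNq : left_inverse (Quat 0 0 0 0) oppq addq.
Proof. by move=> [????]; rewrite /addq/= !addNr. Qed.

HB.instance Definition _ :=
  GRing.isZmodule.Build (quaternion R) addqA addqC add0q addNq.

Definition mulq p q :=
  Quat (q1 p * q1 q - q2 p * q2 q - q3 p * q3 q - q4 p * q4 q)
       (q1 p * q2 q + q2 p * q1 q + q3 p * q4 q - q4 p * q3 q)
       (q1 p * q3 q - q2 p * q4 q + q3 p * q1 q + q4 p * q2 q)
       (q1 p * q4 q + q2 p * q3 q - q3 p * q2 q + q4 p * q1 q).

Lemma mulqA : associative mulq.
Proof. by move=> [????] [????] [????]; rewrite /mulq/=; congr Quat; ring. Qed.
Lemma mul1q : left_id (Quat 1 0 0 0) mulq.
Proof. by move=> [????]; rewrite /mulq/=; congr Quat; ring. Qed.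
Lemma mulq1 : right_id (Quat 1 0 0 0) mulq.
Proof. by move=> [????]; rewrite /mulq/=; congr Quat; ring. Qed.
Lemma mulqDl : left_distributive mulq +%R.
Proof. by move=> [????] [????] [????]; congr Quat => /=; ring. Qed.
Lemma mulqDr : right_distributive mulq +%R.
Proof. by move=> [????] [????] [????]; congr Quat => /=; ring. Qed.
Lemma oneq_neq0 : Quat 1 0 0 0 != 0 :> quaternion R.
Proof. by apply/eqP => -[/eqP]; rewrite oner_eq0. Qed.

HB.instance Definition _ := GRing.Zmodule_isNzRing.Build (quaternion R)
  mulqA mul1q mulq1 mulqDl mulqDr oneq_neq0.

Definition normq2 q : R := q1 q ^+ 2 + q2 q ^+ 2 + q3 q ^+ 2 + q4 q ^+ 2.

Definition invq q :=
  Quat (q1 q / normq2 q) (- q2 q / normq2 q)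
       (- q3 q / normq2 q) (- q4 q / normq2 q).

Lemma normq2_eq0 q : (normq2 q == 0) = (q == 0).
Proof.
case: q => a b c d; rewrite /normq2/= !paddr_eq0 ?addr_ge0 ?sqr_ge0// !sqrf_eq0.
apply/idP/eqP => [/andP[/andP[/andP[/eqP-> /eqP->] /eqP->] /eqP->]//|].
by case=> -> -> -> ->; rewrite eqxx.
Qed.

Lemma mulVq : {in [pred q | q != 0], left_inverse 1 invq *%R}.
Proof.
move=> q; rewrite inE -normq2_eq0 /normq2; case: q => a b c d /= n0.
by congr Quat; rewrite /= /normq2/=; field.
Qed.

Lemma mulqV : {in [pred q | q != 0], right_inverse 1 invq *%R}.
Proof.
move=> q; rewrite inE -normq2_eq0 /normq2; case: q => a b c d /= n0.
by congr Quat; rewrite /= /normq2/=; field.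
Qed.

Lemma unitq_intro p q : q * p = 1 /\ p * q = 1 -> p != 0.
Proof.
by move=> [qp1 _]; apply: contraTneq (oner_neq0 (quaternion R)) => p0;
  rewrite -qp1 p0 mulr0 eqxx.
Qed.

Lemma invq_out : {in [predC [pred q | q != 0]], invq =1 id}.
Proof.
by move=> q; rewrite !inE negbK => /eqP->; rewrite /invq/= oppr0 mul0r.
Qed.

HB.instance Definition _ := GRing.NzRing_hasMulInverse.Build (quaternion R)
  mulVq mulqV unitq_intro invq_out.

Lemma unitqE q : (q \is a GRing.unit) = (q != 0).
Proof. by []. Qed.

End Ring.

Section Quaternion.
Variable R : realType.
Local Notation H := (quaternion R).
Implicit Types (P : {poly H}) (b c q : H).

Definition conj_class q : set H := [set w * q * w^-1 | w in [set w | w != 0]].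

Definition quadp b c : {poly H} := 'X^2 + b%:P * 'X + c%:P.

(* Over a noncommutative ring [horner] puts the coefficients on the left. *)
Lemma horner_quadp b c q : (quadp b c).[q] = q ^+ 2 + b * q + c.
Proof. by rewrite /quadp !hornerD hornerXn hornerMX !hornerC. Qed.

Lemma horner_deriv_quadp b c q : (quadp b c)^`().[q] = 2%:R * q + b.
Proof.
rewrite /quadp !derivD derivXn derivM derivX !derivC mul0r mulr1 add0r addr0.
by rewrite hornerD hornerC hornerMn hornerX mulr_natl.
Qed.

Definition left_newton P q : H := q - (P^`().[q])^-1 * P.[q].

Definition right_newton P q : H := q - P.[q] * (P^`().[q])^-1.

Definition halley_delta P q : H := P^`().[q] - P.[q] * (P^`().[q])^-1.

Definition halley P q : H :=
  q - (P^`().[q])^-1 * P.[q]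
    - (P^`().[q])^-1 * (halley_delta P q)^-1 * P.[q]
      * (P^`().[q])^-1 * P.[q].

Variant method := LeftNewton | RightNewton | Halley.

Definition iteration (m : method) P : H -> H :=
  match m with
  | LeftNewton => left_newton P
  | RightNewton => right_newton P
  | Halley => halley P
  end.

(* [iteration m P] is total because 0^-1 = 0; this is the set where the
   inverses in its formula genuinely exist. *)
Definition iteration_domain (m : method) P : set H :=
  match m with
  | LeftNewton | RightNewton => [set q | P^`().[q] \is a GRing.unit]
  | Halley => [set q | P^`().[q] \is a GRing.unit /\
                       halley_delta P q \is a GRing.unit]
  end.

Definition vec_of_quat q : 'rV[R]_4 :=
  \row_j [:: q1 q; q2 q; q3 q; q4 q]`_j.

Definition quat_of_vec (v : 'rV[R]_4) : H :=
  Quat (v 0 (inord 0)) (v 0 (inord 1)) (v 0 (inord 2)) (v 0 (inord 3)).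

Lemma vec_of_quatK : cancel vec_of_quat quat_of_vec.
Proof. by case=> a b c d; rewrite /quat_of_vec !mxE !inordK. Qed.

Lemma quat_of_vecK : cancel quat_of_vec vec_of_quat.
Proof.
move=> v; apply/rowP => j; rewrite !mxE/=.
by case: j => -[|[|[|[|//]]]] ltj4 /=; congr (v 0 _); apply: val_inj;
  rewrite /= inordK.
Qed.

Definition vec_map (f : H -> H) : 'rV[R]_4 -> 'rV[R]_4 :=
  vec_of_quat \o f \o quat_of_vec.

Definition coordf (F : 'rV[R]_4 -> 'rV[R]_4) (i : 'I_4) : 'rV[R]_4 -> R :=
  fun v => F v 0 i.

Definition has_partials (F : 'rV[R]_4 -> 'rV[R]_4) (v : 'rV[R]_4) : Prop :=
  forall i j : 'I_4, derivable (coordf F i) v (delta_mx 0 j).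

Definition partials_mx (F : 'rV[R]_4 -> 'rV[R]_4) (v : 'rV[R]_4) : 'M[R]_4 :=
  \matrix_(i, j) 'D_(delta_mx 0 j) (coordf F i) v.

(* [jacobian] acts on row vectors from the right, hence the transpose. *)
Lemma partials_mxE F v : differentiable F v -> partials_mx F v = ('J F v)^T.
Proof.
move=> dF; apply/matrixP => i j; rewrite !mxE.
have dFj : derivable F v (delta_mx 0 j) by exact: diff_derivable.
by rewrite -deriveE// derive_mx// !mxE.
Qed.

End Quaternion.

(* Main.v *)
(** At a root [a] put [u = - (a + b)], so that [P' a = a - u] and, for real [t],
    [P (a + t h) = t (h a - u h + t h^2)].  A root in a class other than that of
    [a] forces [P' a <> 0].  The derivatives of the left and right Newton maps at
    [a] are then [h |-> (P' a)^-1 (a h - h a)] and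
    [h |-> (u h - h u) (P' a)^-1]; the extra term of the Halley map is of second
    order in [P] and contributes nothing.  A commutator map [h |-> p h - h p]
    has rank at most 2: it vanishes if [p] is real, and otherwise its kernel
    contains the independent vectors [1] and [p]. *)

Require Import Defs.
From HB Require Import structures.
From mathcomp Require Import all_boot all_order all_algebra.
From mathcomp Require Import ring.
From mathcomp Require Import all_classical all_reals all_analysis.
Import Order.TTheory GRing.Theory Num.Theory.
Import numFieldNormedType.Exports.
Local Open Scope classical_set_scope.
Local Open Scope ring_scope.

(** * Real scalars, lines and conjugacy classes *)

Definition realq {R : realType} (t : R) : quaternion R := Quat t 0 0 0.

Lemma quat_eqP {R : realType} (p q : quaternion R) :
  q1 p = q1 q -> q2 p = q2 q -> q3 p = q3 q -> q4 p = q4 q -> p = q.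
Proof. by case: p => ????; case: q => ???? /= -> -> -> ->. Qed.

Lemma realqC {R : realType} (t : R) (q : quaternion R) :
  q * realq t = realq t * q.
Proof. by apply: quat_eqP => /=; ring. Qed.

Lemma realqCA {R : realType} (t : R) (p q : quaternion R) :
  p * (realq t * q) = realq t * (p * q).
Proof. by rewrite mulrA realqC -mulrA. Qed.

Lemma quat_of_vec_line {R : realType} (t : R) (v w : 'rV[R]_4) :
  quat_of_vec (t *: v + w) = realq t * quat_of_vec v + quat_of_vec w.
Proof. by apply: quat_eqP; rewrite /= !mxE; ring. Qed.

Lemma vec_of_quat_line {R : realType} (t : R) (p q : quaternion R) :
  vec_of_quat (realq t * p + q) = t *: vec_of_quat p + vec_of_quat q.
Proof.
by rewrite -[RHS]quat_of_vecK quat_of_vec_line !vec_of_quatK.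
Qed.

Lemma conj_class_eq {R : realType} (p q : quaternion R) :
  conj_class q p -> conj_class p = conj_class q.
Proof.
move=> [w /= w0 <-{p}]; have wU : w \is a GRing.unit by rewrite unitqE.
apply/seteqP; split=> r [v /= v0 <-{r}];
  have vU : v \is a GRing.unit by rewrite unitqE.
  exists (v * w); first by rewrite /= -unitqE unitrMr.
  by rewrite invrM// !mulrA.
exists (v * w^-1); first by rewrite /= -unitqE unitrMr// unitrV.
by rewrite invrM ?unitrV// invrK !mulrA !mulrVK.
Qed.

(** * Coordinatewise limits of quaternion-valued functions *)

Section QuaternionLimit.
Context {R : realType} {T : Type} {F : set_system T} {FF : Filter F}.
Implicit Types (f g : T -> quaternion R) (l p q : quaternion R).

(* Limits are taken coordinatewise since [quaternion R] has no topology. *)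
Definition qcvg f l :=
  [/\ q1 (f x) @[x --> F] --> q1 l, q2 (f x) @[x --> F] --> q2 l,
      q3 (f x) @[x --> F] --> q3 l & q4 (f x) @[x --> F] --> q4 l].

Lemma qcvg_cst l : qcvg (fun=> l) l.
Proof. by split; exact: cvg_cst. Qed.

Lemma qcvgD f g p q : qcvg f p -> qcvg g q -> qcvg (fun x => f x + g x) (p + q).
Proof. by move=> [????] [????]; split; exact: cvgD. Qed.

Lemma qcvgN f p : qcvg f p -> qcvg (fun x => - f x) (- p).
Proof. by move=> [????]; split; exact: cvgN. Qed.

Lemma qcvgB f g p q : qcvg f p -> qcvg g q -> qcvg (fun x => f x - g x) (p - q).
Proof. by move=> fp gq; apply: qcvgD => //; exact: qcvgN. Qed.

Lemma qcvgM f g p q : qcvg f p -> qcvg g q -> qcvg (fun x => f x * g x) (p * q).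
Proof.
move=> [f1 f2 f3 f4] [g1 g2 g3 g4]; split.
- exact: cvgB (cvgB (cvgB (cvgM f1 g1) (cvgM f2 g2)) (cvgM f3 g3)) (cvgM f4 g4).
- exact: cvgB (cvgD (cvgD (cvgM f1 g2) (cvgM f2 g1)) (cvgM f3 g4)) (cvgM f4 g3).
- exact: cvgD (cvgD (cvgB (cvgM f1 g3) (cvgM f2 g4)) (cvgM f3 g1)) (cvgM f4 g2).
- exact: cvgD (cvgB (cvgD (cvgM f1 g4) (cvgM f2 g3)) (cvgM f3 g2)) (cvgM f4 g1).
Qed.

(** The inverse is the conjugate divided by the squared norm, whose limit is nonzero. *)
Lemma qcvgV f p : p != 0 -> qcvg f p -> qcvg (fun x => (f x)^-1) p^-1.
Proof.
move=> p0 [f1 f2 f3 f4].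
have nV : (normq2 (f x))^-1 @[x --> F] --> (normq2 p)^-1.
  apply: cvgV; first by rewrite normq2_eq0.
  by do 3?apply: cvgD; rewrite expr2; under eq_fun do rewrite expr2; exact: cvgM.
by split; apply: cvgM => //; exact: cvgN.
Qed.

Lemma qcvg_coord f l (i : 'I_4) :
  qcvg f l -> vec_of_quat (f x) 0 i @[x --> F] --> vec_of_quat l 0 i.
Proof.
move=> [????]; rewrite mxE; under eq_fun do rewrite mxE.
by case: i => -[|[|[|[|//]]]].
Qed.

End QuaternionLimit.

(** * Jacobians along lines and the rank of commutator maps *)

Lemma qcvg_realq {R : realType} : qcvg (F := (0 : R)^') realq 0.
Proof.
by split; [exact: cvg_within|exact: cvg_cst|exact: cvg_cst|exact: cvg_cst].
Qed.

(** [g h t] is the difference quotient in direction [h] with [t] already cancelled, so its limit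
    [L h] is the directional derivative. Basis vectors [h] give the columns of the Jacobian, whereas
    [lin1_mx] stores them as rows, hence the transpose. *)
Lemma partials_of_line {R : realType} (f L : quaternion R -> quaternion R)
    (g : quaternion R -> R -> quaternion R) (a : quaternion R) :
    (forall h t, f (realq t * h + a) - f a = realq t * g h t) ->
    (forall h, qcvg (F := (0 : R)^') (g h) (L h)) ->
  has_partials (vec_map f) (vec_of_quat a) /\
  partials_mx (vec_map f) (vec_of_quat a) = (lin1_mx (vec_map L))^T.
Proof.
move=> fg gL.
have cvgq i j : (t^-1 *: (coordf (vec_map f) i (t *: delta_mx 0 j + vec_of_quat a)
    - coordf (vec_map f) i (vec_of_quat a))) @[t --> (0 : R)^'] -->
    vec_map L (delta_mx 0 j) 0 i.
  have := qcvg_coord _ _ i (gL (quat_of_vec (delta_mx 0 j))).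
  apply: cvg_trans; apply: near_eq_cvg; near=> t.
  have t0 : t != 0 by near: t; exact: nbhs_dnbhs_neq.
  rewrite /coordf /vec_map /= quat_of_vec_line vec_of_quatK.
  move: (fg (quat_of_vec (delta_mx 0 j)) t) => /(canRL (subrK _)) ->.
  by rewrite vec_of_quat_line !mxE addrK [RHS]mulKf.
split=> [i j|]; first exact: cvgP (cvgq i j).
by apply/matrixP => i j; rewrite mxE [RHS]mxE [RHS]mxE; apply: cvg_lim (cvgq i j).
Unshelve. all: by end_near. Qed.

(** The outer factors let one bound serve both left and right methods; whatever commutes with [p] is
    still sent to [0]. *)
Lemma rank_commutator {R : realType} (v w p : quaternion R) :
  (\rank (lin1_mx (vec_map (fun h => v * (p * h - h * p) * w)%R)) <= 2)%N.
Proof.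
set L := fun h => _; set M := lin1_mx _.
have L_line t x y : L (realq t * x + y) = realq t * L x + L y.
  by rewrite /L; apply: quat_eqP => /=; ring.
have linL : linear (vec_map L).
  move=> t x y; rewrite /vec_map /=.
  by rewrite quat_of_vec_line L_line vec_of_quat_line.
pose Ll : {linear 'rV[R]_4 -> 'rV[R]_4} :=
  HB.pack (vec_map L) (GRing.isLinear.Build _ _ _ _ (vec_map L) linL).
have ME q : vec_of_quat q *m M = vec_of_quat (L q).
  by rewrite (mul_rV_lin1 Ll) /= /vec_map /= vec_of_quatK.
have vec0 : vec_of_quat (0 : quaternion R) = 0.
  by apply/rowP => -[[|[|[|[|//]]]] ?]; rewrite !mxE.
have L0 q : p * q = q * p -> L q = 0 by rewrite /L => ->; rewrite subrr mulr0 mul0r.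
have [pr|pNr] := eqVneq p (realq (q1 p)).
  suff -> : M = 0 by rewrite mxrank0.
  apply/row_matrixP => i; rewrite rowE -[delta_mx 0 i]quat_of_vecK ME L0 ?vec0 ?row0//.
  by rewrite pr realqC.
(* Both rows commute with [p], so [A *m M = 0]; as [A] has rank 2, at most 4 - 2 is left for the
   rank of [M]. *)
pose A := col_mx (vec_of_quat 1) (vec_of_quat p).
have A_free : row_free A.
  apply: inj_row_free => /= z; rewrite -[z]hsubmxK mul_row_col.
  rewrite [lsubmx z]mx11_scalar [rsubmx z]mx11_scalar !mul_scalar_mx.
  set s := lsubmx z 0 0; set t := rsubmx z 0 0 => e.
  have {}e : realq s * 1 + realq t * p = 0.
    apply: (can_inj (@vec_of_quatK R)).
    by rewrite vec_of_quat_line -[realq t * p]addr0 vec_of_quat_line vec0 addr0.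
  have t0 : t = 0.
    (* For nonzero [t], the imaginary coordinates of [s + t p = 0] would force [p] to be real. *)
    apply/eqP; apply: contraNT pNr => tn0; apply/eqP.
    by case: e => _ e2 e3 e4; apply: quat_eqP => //=;
      apply: (mulfI tn0); rewrite mulr0;
      [rewrite -[RHS]e2|rewrite -[RHS]e3|rewrite -[RHS]e4]; ring.
  have s0 : s = 0 by case: e => <- _ _ _ /=; rewrite t0; ring.
  by rewrite s0 t0 !raddf0 row_mx0.
have := mulmx0_rank_max (A := A) (B := M).
rewrite mul_col_mx !ME !L0 ?mulr1 ?mul1r// vec0 col_mx0 (eqP A_free) => /(_ erefl).
by rewrite (leq_add2l 2 _ 2).
Qed.

(** * The quadratic and its iterations near a root *)

Section QuadraticAtRoot.
Context {R : realType} (b c a : quaternion R).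
Hypothesis ra : root (quadp b c) a.
Local Notation P := (quadp b c).

(** A zero derivative means [b = - 2 a]. Then any root [z] satisfies
    [(z - a) z - a (z - a) = P(z) - P(a) = 0], so [z - a], if nonzero, conjugates [z] to [a], and
    all roots would share one class. *)
Lemma deriv_quadp_neq0 :
  (exists x y, [/\ root P x, root P y & conj_class x <> conj_class y]) ->
  P^`().[a] != 0.
Proof.
move=> [x [y [rx ry xy]]].
have [z rz za] : exists2 z, root P z & conj_class a <> conj_class z.
  have [ax|] := pselect (conj_class a = conj_class x); last by exists x.
  by exists y; rewrite // ax.
apply/eqP; rewrite horner_deriv_quadp => Da; apply: za; apply: conj_class_eq.
have bE : b = - (2%:R * a) by apply/eqP; rewrite -addr_eq0 addrC Da.
have [->|zna] := eqVneq z a.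
  by exists 1; rewrite /= ?oner_neq0// invr1 mulr1 mul1r.
exists (z - a); first by rewrite /= subr_eq0.
have zaU : z - a \is a GRing.unit by rewrite unitqE subr_eq0.
apply: (mulIr zaU); rewrite mulrVK//.
apply/eqP; rewrite -subr_eq0; apply/eqP.
transitivity (P.[z] - P.[a]); last by rewrite (rootP rz) (rootP ra) subrr.
rewrite !horner_quadp bE !expr2 mulr_natl mulr2n.
by apply: quat_eqP => /=; ring.
Qed.

(** The quotient of [P(a + t h)] by [t], kept polynomial in [t] so that its limit at [0] can be read
    off. *)
Definition quad_quotient h t := h * a + (a + b) * h + realq t * h ^+ 2.

Lemma quadp_line h t : P.[realq t * h + a] = realq t * quad_quotient h t.
Proof.
rewrite -[RHS]addr0 -(rootP ra) !horner_quadp /quad_quotient !expr2.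
by apply: quat_eqP => /=; ring.
Qed.

Let D h t := P^`().[realq t * h + a].

Lemma qcvg_quad_quotient h :
  qcvg (F := (0 : R)^') (quad_quotient h) (h * a + (a + b) * h).
Proof.
rewrite -[X in qcvg _ X]addr0 -(mul0r (h ^+ 2)).
apply: qcvgD; first exact: qcvg_cst.
by apply: qcvgM; [exact: qcvg_realq|exact: qcvg_cst].
Qed.

Lemma qcvg_line h : qcvg (F := (0 : R)^') (fun t => realq t * h + a) a.
Proof.
rewrite -[X in qcvg _ X]add0r -(mul0r h).
by apply: qcvgD; [apply: qcvgM; [exact: qcvg_realq|]|]; exact: qcvg_cst.
Qed.

Lemma qcvg_deriv h : qcvg (F := (0 : R)^') (D h) P^`().[a].
Proof.
rewrite /D horner_deriv_quadp; under eq_fun do rewrite horner_deriv_quadp.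
apply: qcvgD; last exact: qcvg_cst.
by apply: qcvgM; [exact: qcvg_cst|exact: qcvg_line].
Qed.

Hypothesis Da0 : P^`().[a] != 0.
Let w := P^`().[a]^-1.

Lemma qcvg_derivV h : qcvg (F := (0 : R)^') (fun t => (D h t)^-1) w.
Proof. by apply: qcvgV => //; exact: qcvg_deriv. Qed.

Lemma halley_delta_root : halley_delta P a = P^`().[a].
Proof. by rewrite /halley_delta (rootP ra) mul0r subr0. Qed.

Lemma qcvg_quadp h : qcvg (F := (0 : R)^') (fun t => P.[realq t * h + a]) 0.
Proof.
under eq_fun do rewrite quadp_line.
rewrite -(mul0r (h * a + (a + b) * h)).
by apply: qcvgM; [exact: qcvg_realq|exact: qcvg_quad_quotient].
Qed.

(** Multiplying on the left by [P'(a) = 2 a + b] cancels the terms in [b] and leaves [a h - h a].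
    The final [1] only matches the shape [v * (p * h - h * p) * w]. *)
Lemma left_newton_rate h :
  h - w * (h * a + (a + b) * h) = w * (a * h - h * a) * 1.
Proof.
have DaU : P^`().[a] \is a GRing.unit by rewrite unitqE.
apply: (mulrI DaU); rewrite mulrBr mulr1 !(mulVKr DaU).
rewrite horner_deriv_quadp mulr_natl mulr2n.
by apply: quat_eqP => /=; ring.
Qed.

(** Multiplying on the right by [2 a + b] leaves the commutator with [u = - (a + b)], the other
    factor in [P = (x - u)(x - a)]. *)
Lemma right_newton_rate h :
  h - (h * a + (a + b) * h) * w = 1 * (- (a + b) * h - h * - (a + b)) * w.
Proof.
have DaU : P^`().[a] \is a GRing.unit by rewrite unitqE.
apply: (mulIr DaU); rewrite mulrBl mul1r !(mulrVK DaU).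
rewrite horner_deriv_quadp mulr_natl mulr2n.
by apply: quat_eqP => /=; ring.
Qed.

Lemma partials_iteration m : exists v p w',
  let F := vec_map (iteration m P) in
  has_partials F (vec_of_quat a) /\
  partials_mx F (vec_of_quat a) =
    (lin1_mx (vec_map (fun h => v * (p * h - h * p) * w')))^T.
Proof.
case: m => /=.
- exists w, a, 1.
  apply: (@partials_of_line _ _ _
    (fun h t => h - (D h t)^-1 * quad_quotient h t)) => h.
    move=> t; rewrite /left_newton (rootP ra) mulr0 subr0 quadp_line -/(D h t).
    by rewrite realqCA addrAC addrK mulrBr.
  rewrite -left_newton_rate; apply: qcvgB; first exact: qcvg_cst.
  by apply: qcvgM; [exact: qcvg_derivV|exact: qcvg_quad_quotient].
- exists 1, (- (a + b)), w.
  apply: (@partials_of_line _ _ _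
    (fun h t => h - quad_quotient h t * (D h t)^-1)) => h.
    move=> t; rewrite /right_newton (rootP ra) mul0r subr0 quadp_line -/(D h t).
    by rewrite -mulrA addrAC addrK mulrBr.
  rewrite -right_newton_rate; apply: qcvgB; first exact: qcvg_cst.
  by apply: qcvgM; [exact: qcvg_quad_quotient|exact: qcvg_derivV].
- exists w, a, 1.
  apply: (@partials_of_line _ _ _ (fun h t => h - (D h t)^-1 * quad_quotient h t
     - (D h t)^-1 * (halley_delta P (realq t * h + a))^-1
       * P.[realq t * h + a] * (D h t)^-1 * quad_quotient h t)) => h.
    move=> t; rewrite /halley (rootP ra) !mulr0 !subr0 -/(D h t).
    (* Only the last factor [P] of each correction yields the factor [t]; the other [P] in the
       Halley term stays and tends to [0]. *)
    rewrite [X in _ - _ - _ * X - _ = _]quadp_line.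
    rewrite [X in _ - _ * X - _ - _ = _]quadp_line.
    by rewrite !realqCA addrAC [X in X - _ = _]addrAC addrK !mulrBr.
  rewrite -left_newton_rate -[X in qcvg _ X]subr0; apply: qcvgB.
    apply: qcvgB; first exact: qcvg_cst.
    by apply: qcvgM; [exact: qcvg_derivV|exact: qcvg_quad_quotient].
  (* The limit [0] is written as [w * w * 0 * w * (h * a + (a + b) * h)], one factor for each factor
     of the Halley term. *)
  rewrite -(mul0r (h * a + (a + b) * h)) -(mul0r w) -(mulr0 (w * w)).
  apply: qcvgM (qcvg_quad_quotient h); apply: qcvgM (qcvg_derivV h).
  apply: qcvgM (qcvg_quadp h); apply: qcvgM; first exact: qcvg_derivV.
  apply: qcvgV => //; rewrite /halley_delta -[X in qcvg _ X]subr0 -(mul0r w).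
  apply: qcvgB; first exact: qcvg_deriv.
  by apply: qcvgM; [exact: qcvg_quadp|exact: qcvg_derivV].
Qed.

End QuadraticAtRoot.

Theorem theorem6 (R : realType) (b c : quaternion R)
    (two_classes : exists x y : quaternion R,
      [/\ root (quadp b c) x, root (quadp b c) y
        & conj_class x <> conj_class y])
    (m : method) (alpha : quaternion R) (root_alpha : root (quadp b c) alpha) :
  let F := vec_map (iteration m (quadp b c)) in
  let D := partials_mx F (vec_of_quat alpha) in
  [/\ iteration_domain m (quadp b c) alpha,
      has_partials F (vec_of_quat alpha),
      \det D = 0
    & (\rank D <= 2)%N].
Proof.
move=> F D; have Da0 := deriv_quadp_neq0 b c alpha root_alpha two_classes.
have [v [p [w [partialsF DE]]]] := partials_iteration b c alpha root_alpha Da0 m.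
have rankD : (\rank D <= 2)%N by rewrite /D DE mxrank_tr rank_commutator.
split=> //.
  (* At a root [halley_delta] equals the derivative, so every domain condition reduces to [Da0]. *)
  by case: m {F D partialsF DE rankD} => //=; rewrite halley_delta_root.
(* A nonzero determinant would give [D] rank 4. *)
apply/eqP/negPn; rewrite -unitfE -[_ \is a _]/(D \in unitmx) -row_free_unit /row_free.
by apply: contraTN rankD => /eqP ->.
Qed.
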